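(* Let $p\ge2$. The number of labels (i.e. of $p$-tuples) in any normalized lasso-type code of dimension $p$ is at most $\hat N(p)$, where for $\ell\ge1$ $$\hat N(2\ell+1)=2\Big(\sum_{j=0}^{\ell-1}\binom{2\ell+1}{2j}h_{2(\ell-j)+1,2}+1\Big)+1,$$ $$\hat N(2\ell)=2\Big(\sum_{j=1}^{\ell-1}\binom{2\ell}{2j-1}h_{2\ell-2j+1,2}+1\Big)+1 .$$
   Context: For $1\le r\le k$, $h_{k,r}$ is the maximal number of binary words of length $k$ such that every two of them match in at least $r$ spots. A normalized lasso-type code of dimension $p$ is a finite sequence of $p$-tuples of symbols from $\{-1,0,1\}$ satisfying: (i) every two consecutive $p$-tuples differ by exactly one change (in exactly one spot), where the allowed changes are $1\leftrightarrow0$ and $-1\leftrightarrow0$; (ii) each $p$-tuple appears at most once in the code; (iii) for any given $k<p$, any two (distinct) $p$-tuples of the code with exactly $k$ zeros, these zeros occupying the same spots in both, match in at least two of the remaining nonzero spots; (iv) there is only one $p$-tuple in the code that has all but one spots equal to zero; that $p$-tuple is followed by the zero $p$-tuple, which is the last $p$-tuple of the code. The $p$-tuples in a code are also called labels. Empty sums are $0$. *)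

(* Defs.v *)
From HB Require Import structures.
From mathcomp Require Import all_boot all_order all_algebra.

Set Implicit Arguments.
Unset Strict Implicit.
Unset Printing Implicit Defensive.

Definition matches (T : eqType) (n : nat) (u v : n.-tuple T) : nat :=
  #|[set i : 'I_n | tnth u i == tnth v i]|.

Definition pairwise_matching (k r : nat) (W : {set k.-tuple bool}) : bool :=
  [forall u in W, forall v in W, (u != v) ==> (r <= matches u v)].

(* Meant for 1 <= r <= k: the words form a set, so "every two words" are distinct. *)
Definition h (k r : nat) : nat :=
  \max_(W : {set k.-tuple bool} | pairwise_matching r W) #|W|.

Definition symbols : seq int := [:: -1; 0; 1]%R.

Definition allowed_changes : seq (int * int) :=
  [:: (1, 0); (0, 1); (-1, 0); (0, -1)]%R.

Definition one_change (p : nat) (x y : p.-tuple int) : bool :=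
  [exists i, ((tnth x i, tnth y i) \in allowed_changes)
             && [forall j, (j != i) ==> (tnth x j == tnth y j)]].

Definition zeros (p : nat) (x : p.-tuple int) : {set 'I_p} :=
  [set i | tnth x i == 0%R].

Definition zero_label (p : nat) : p.-tuple int := [tuple of nseq p 0%R].

(* Counts matches outside the zeros; used only when zeros x = zeros y. *)
Definition nonzero_matches (p : nat) (x y : p.-tuple int) : nat :=
  #|[set i | (tnth x i != 0%R) && (tnth x i == tnth y i)]|.

Record normalized_lasso_code (p : nat) (c : seq (p.-tuple int)) : Prop := {
  nlc_symbols : forall x, x \in c -> forall i, tnth x i \in symbols;
  nlc_step : sorted (@one_change p) c;
  nlc_uniq : uniq c;
  nlc_match : forall k, k < p ->
    forall x y, x \in c -> y \in c -> x != y ->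
      #|zeros x| = k -> zeros x = zeros y -> 2 <= nonzero_matches x y;
  nlc_end : exists x : p.-tuple int, exists c' : seq (p.-tuple int),
    [/\ #|zeros x|.+1 = p,
        forall y, y \in c -> #|zeros y|.+1 = p -> y = x
      & c = c' ++ [:: x; zero_label p]]
}.

(* All natural-number subtractions below are exact on the summation ranges. *)
Definition Nhat (p : nat) : nat :=
  let l := p./2 in
  if odd p then
    2 * (\sum_(0 <= j < l) 'C(2 * l + 1, 2 * j) * h (2 * (l - j) + 1) 2 + 1) + 1
  else
    2 * (\sum_(1 <= j < l) 'C(2 * l, 2 * j - 1) * h (2 * l - 2 * j + 1) 2 + 1)
    + 1.

Lemma Nhat_odd (l : nat) :
  Nhat (2 * l + 1) =
  2 * (\sum_(0 <= j < l) 'C(2 * l + 1, 2 * j) * h (2 * (l - j) + 1) 2 + 1) + 1.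
Proof.
have half_l : (2 * l + 1)./2 = l by rewrite addn1 mul2n /= uphalf_double.
by rewrite /Nhat half_l oddD oddM.
Qed.

Lemma Nhat_even (l : nat) :
  Nhat (2 * l) =
  2 * (\sum_(1 <= j < l) 'C(2 * l, 2 * j - 1) * h (2 * l - 2 * j + 1) 2 + 1)
  + 1.
Proof.
have half_l : (2 * l)./2 = l by rewrite mul2n doubleK.
by rewrite /Nhat half_l oddM.
Qed.

(* Main.v *)
Require Import Defs.
From mathcomp Require Import all_boot all_order all_algebra.
From mathcomp Require Import zify.

(** Every step changes the number of zeros by one, so labels with an odd and
    with an even number of nonzero entries alternate; hence a code with [m]
    labels of odd type has at most [2 * m + 1] labels. For a fixed set [Z] of
    zeros, the signs of the nonzero entries turn the labels vanishing exactly
    on [Z] into words of length [p - #|Z|] any two of which match at least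
    twice, so there are at most [h (p - #|Z|) 2] of them. The labels with a
    single nonzero entry contribute only one to the count of odd type. *)

Set Implicit Arguments.
Unset Strict Implicit.
Unset Printing Implicit Defensive.

Lemma size_le_alternating (T : Type) (e : rel T) (P : pred T) (s : seq T) :
  (forall x y, e x y -> P y = ~~ P x) ->
  sorted e s -> size s <= 2 * count P s + 1.
Proof.
move=> eP; case: s => [|x s] //= xs.
(* Strengthened for the induction: the spare unit is available only when the first element fails
   [P]. *)
suff: (size s).+1 <= 2 * (P x + count P s) + ~~ P x by case: (P x) => /=; lia.
elim: s x xs => [|y s IHs] x /=; first by case: (P x).
case/andP=> /eP Py /IHs; rewrite Py; case: (P x) => /=; lia.
Qed.

Lemma count_comp_sum (T : Type) (f : T -> nat) (Q : pred nat) n (s : seq T) :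
  (forall x, f x < n) ->
  count (fun x => Q (f x)) s =
  \sum_(0 <= i < n | Q i) count (fun x => f x == i) s.
Proof.
move=> fn; elim: s => [|x s IHs] /=; first by rewrite big1.
rewrite big_split /= -IHs; congr addn.
rewrite big_mkcond (bigD1_seq (f x)) ?mem_index_iota ?iota_uniq ?fn //=.
rewrite eqxx big1 ?addn0; first by case: (Q _).
by move=> i /negPf; rewrite eq_sym => ->; case: (Q i).
Qed.

Lemma big_nat_double (F : nat -> nat) n :
  \sum_(0 <= i < n.*2) F i = \sum_(0 <= j < n) (F j.*2 + F j.*2.+1).
Proof.
elim: n => [|n IHn]; first by rewrite !big_geq.
by rewrite doubleS !big_nat_recr //= IHn addnA.
Qed.

Section Labels.

Variable p : nat.
Implicit Types (x y : p.-tuple int) (Z : {set 'I_p}) (c : seq (p.-tuple int)).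

(** Away from the changed spot [i] the two zero sets agree, and every allowed change has [0] on
    exactly one side. *)
Lemma one_change_odd_zeros x y :
  one_change x y -> odd #|zeros y| = ~~ odd #|zeros x|.
Proof.
case/existsP=> i /andP[xyi /forallP xy].
rewrite (cardsD1 i (zeros x)) (cardsD1 i (zeros y)).
have -> : zeros y :\ i = zeros x :\ i.
  apply/setP=> j; rewrite !inE; case: eqP => //= /eqP ji.
  by move: (xy j); rewrite ji /= => /eqP ->.
rewrite !oddD !oddb !inE; move: xyi.
by rewrite !inE => /or4P[] /eqP[-> ->] /=; case: odd.
Qed.

(** Taken with [A] the complement of the zero set, where the sign determines the symbol; [enum_val]
    renumbers the spots of [A] to give a word of length [#|A|]. *)
Definition sign_word (A : {set 'I_p}) x : #|A|.-tuple bool :=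
  [tuple (0 < tnth x (enum_val i))%R | i < #|A|].

Lemma eq_symbol_sign (a b : int) :
  a \in symbols -> b \in symbols -> a != 0%R -> b != 0%R ->
  (a == b) = ((0 < a)%R == (0 < b)%R).
Proof.
by rewrite !inE => /or3P[] /eqP-> /or3P[] /eqP->.
Qed.

Lemma eq_sign_word Z x y (i : 'I_#|~: Z|) :
  (forall j, tnth x j \in symbols) -> (forall j, tnth y j \in symbols) ->
  zeros x = Z -> zeros y = Z ->
  (tnth (sign_word (~: Z) x) i == tnth (sign_word (~: Z) y) i) =
  (tnth x (enum_val i) == tnth y (enum_val i)).
Proof.
move=> sx sy Zx Zy; rewrite !tnth_mktuple -eq_symbol_sign //.
  by have := enum_valP i; rewrite -{2}Zx !inE.
by have := enum_valP i; rewrite -{2}Zy !inE.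
Qed.

Lemma sign_word_inj Z x y :
  (forall j, tnth x j \in symbols) -> (forall j, tnth y j \in symbols) ->
  zeros x = Z -> zeros y = Z ->
  sign_word (~: Z) x = sign_word (~: Z) y -> x = y.
Proof.
move=> sx sy Zx Zy exy; apply: eq_from_tnth => i.
have [iZ|niZ] := boolP (i \in Z).
  have := iZ; rewrite -Zx inE => /eqP->.
  by move: iZ; rewrite -Zy inE => /eqP->.
have iC : i \in ~: Z by rewrite inE.
rewrite -(enum_rankK_in iC iC); apply/eqP.
by rewrite -(@eq_sign_word Z) // exy.
Qed.

(** A matching nonzero spot lies outside [Z], so it is the image under [enum_val] of a position
    where the sign words match. *)
Lemma nonzero_matches_le_sign_word Z x y :
  (forall j, tnth x j \in symbols) -> (forall j, tnth y j \in symbols) ->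
  zeros x = Z -> zeros y = Z ->
  nonzero_matches x y <= matches (sign_word (~: Z) x) (sign_word (~: Z) y).
Proof.
move=> sx sy Zx Zy; rewrite /matches /nonzero_matches.
rewrite -(card_imset _ (@enum_val_inj _ _)); apply/subset_leq_card/subsetP=> i.
rewrite inE => /andP[xi xyi].
have iC : i \in ~: Z by rewrite -Zx !inE.
rewrite -(enum_rankK_in iC iC) imset_f // inE eq_sign_word //.
by rewrite enum_rankK_in.
Qed.

Lemma count_zeros_le_h c Z :
  normalized_lasso_code c -> #|Z| < p ->
  count (fun x => zeros x == Z) c <= h (p - #|Z|) 2.
Proof.
move=> hc Zp; have <- : #|~: Z| = p - #|Z| by rewrite cardsCs setCK card_ord.
rewrite -size_filter; set L := filter _ c.
have LP x : x \in L ->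
    [/\ x \in c, forall j, tnth x j \in symbols & zeros x = Z].
  by rewrite mem_filter => /andP[/eqP Zx xc]; split=> //; apply: nlc_symbols xc.
pose W := [set w in map (sign_word (~: Z)) L].
have <- : #|W| = size L.
  rewrite cardsE -(size_map (sign_word (~: Z))); apply/card_uniqP.
  rewrite map_inj_in_uniq; first by rewrite filter_uniq // (nlc_uniq hc).
  by move=> x y /LP[_ sx Zx] /LP[_ sy Zy]; apply: sign_word_inj.
(* [W] competes in the maximum defining [h], once its words are shown to match pairwise at least
   twice. *)
apply: (@leq_bigmax_cond _ (pairwise_matching 2) (fun W => #|W|)).
apply/forall_inP=> u; rewrite inE => /mapP[x /LP[xc sx Zx] ->].
apply/forall_inP=> v; rewrite inE => /mapP[y /LP[yc sy Zy] ->].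
apply/implyP=> nuv.
apply: leq_trans (nonzero_matches_le_sign_word sx sy Zx Zy).
apply: (nlc_match hc Zp) => //; rewrite ?Zx ?Zy //.
by apply: contraNneq nuv => ->.
Qed.

(** Labels are grouped by their zero set, one of the ['C(p, k)] subsets of size [k]. *)
Lemma count_card_zeros_le c k :
  normalized_lasso_code c -> k < p ->
  count (fun x => #|zeros x| == k) c <= 'C(p, k) * h (p - k) 2.
Proof.
move=> hc kp; rewrite -sum1_count.
rewrite (partition_big (@zeros p) (fun Z => #|Z| == k)) //=.
rewrite -[X in 'C(X, k)]card_ord -card_draws -sum_nat_const.
under [leqRHS]eq_bigl do rewrite inE.
apply: leq_sum => Z /eqP Zk; rewrite -Zk sum1_count.
apply: leq_trans (count_zeros_le_h hc _); last by rewrite Zk.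
by apply: sub_count => x /= /andP[].
Qed.

Lemma count_one_nonzero_le c :
  normalized_lasso_code c -> count (fun x => #|zeros x| == p.-1) c <= 1.
Proof.
move=> hc; have [x [c' [px ux _]]] := nlc_end hc.
apply: leq_trans (_ : count_mem x c <= 1); last first.
  by rewrite count_uniq_mem ?(nlc_uniq hc) ?leq_b1.
rewrite (@eq_in_count _ _ (pred1 x)) // => y yc.
apply/eqP/eqP=> [yp|->]; last by rewrite -[in RHS]px.
by apply: ux => //; rewrite yp -px.
Qed.

(** The condition [odd i != odd p] says that [p - i], the number of nonzero entries, is odd. *)
Lemma size_lasso_code_le c :
  normalized_lasso_code c ->
  size c <= 2 * (\sum_(0 <= i < p.+1 | odd i != odd p)
                   count (fun x => #|zeros x| == i) c) + 1.
Proof.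
move=> hc; rewrite -(@count_comp_sum _ (fun x => #|zeros x|)
                        (fun i => odd i != odd p)); last first.
  by move=> x; rewrite ltnS -[leqRHS]card_ord max_card.
apply: (size_le_alternating (e := @one_change p)) (nlc_step hc) => x y /=.
by move=> /one_change_odd_zeros ->; case: odd; case: odd.
Qed.

End Labels.

(** The index [p.-1] accounts for the inner [+ 1] of [Nhat]; the other indices of odd type are
    compared term by term. *)
Lemma sum_odd_type_le_Nhat (F : nat -> nat) p :
  1 < p -> (forall k, k < p -> F k <= 'C(p, k) * h (p - k) 2) -> F p.-1 <= 1 ->
  2 * (\sum_(0 <= i < p.+1 | odd i != odd p) F i) + 1 <= Nhat p.
Proof.
move=> p_gt1 FC F1.
have [l [pl|[pl l_gt0]]] : exists l, p = 2 * l + 1 \/ p = 2 * l /\ 0 < l.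
  by exists p./2; have := odd_double_half p; case: (odd p); lia.
- rewrite big_mkcond; subst p.
  rewrite Nhat_odd leq_add2r leq_mul2l /=.
  have -> : (2 * l + 1).+1 = l.+1.*2 by lia.
  (* In each pair [2j], [2j + 1] only the even index survives; the last pair, split off, gives
     [2l = p - 1]. *)
  rewrite big_nat_double big_nat_recr //= oddD oddM !odd_double /= addn0.
  apply: leq_add; last by move: F1; rewrite addn1 mul2n.
  rewrite big_nat [leqRHS]big_nat; apply: leq_sum => j /andP[_ jl].
  rewrite !odd_double /= addn0 -mul2n.
  have -> : 2 * (l - j) + 1 = 2 * l + 1 - 2 * j by lia.
  by apply: FC; lia.
- rewrite big_mkcond; case: l l_gt0 pl => // m _ pl; subst p.
  rewrite Nhat_even leq_add2r leq_mul2l.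
  have even2m : odd (2 * m.+1) = false by rewrite oddM.
  (* The top index [i = p] has the parity of [p] and drops out, leaving an even number of indices to
     pair. *)
  rewrite even2m big_nat_recr // even2m /= addn0.
  rewrite [X in index_iota 0 X]mul2n big_nat_double big_nat_recr //= !odd_double /=.
  apply: leq_add; last by move: F1; rewrite mul2n.
  (* The sum in [Nhat] starts at 1, so its index is shifted to match the odd indices [2j + 1]. *)
  rewrite big_add1 big_nat [leqRHS]big_nat; apply: leq_sum => j /andP[_ jm].
  rewrite !odd_double /= -!mul2n.
  have -> : 2 * m.+1 - 2 * j.+1 + 1 = 2 * m.+1 - (2 * j).+1 by lia.
  have -> : 2 * j.+1 - 1 = (2 * j).+1 by lia.
  by apply: FC; lia.
Qed.

Theorem theorem7p2 (p : nat) (hp : 2 <= p) (c : seq (p.-tuple int))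
  (hc : normalized_lasso_code c) : size c <= Nhat p.
Proof.
apply: leq_trans (size_lasso_code_le hc) _.
apply: sum_odd_type_le_Nhat hp _ (count_one_nonzero_le hc) => k.
exact: count_card_zeros_le.
Qed.
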